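(* Let $(X,\triangleright)$ be a rack with amenable group $G_\psi$ of inner automorphisms. If the conjugation-invariant word norm on $G_\psi$ associated with $\psi(X)=\{\psi_x\mid x\in X\}$ has finite diameter, then: 1. the projection $P\colon H^*_b(X;\mathbb R)\to H^*_{b,\mathrm{inv}}(X;\mathbb R)$ is an isomorphism; 2. the homomorphism $\pi^*\colon\operatorname{Fun}_b(\pi_0(X,\triangleright)^k,\mathbb R)\to H^k_b(X;\mathbb R)$ is an isomorphism for every $k$. Consequently there are isomorphisms $$\operatorname{Fun}_b(\pi_0(X,\triangleright)^k,\mathbb R)\cong H^k_{b,\mathrm{inv}}(X;\mathbb R)\cong H^k_b(X;\mathbb R).$$
   Context: A rack is a non-empty set $X$ with a binary operation $\triangleright$ such that for every $x\in X$ the map $\psi_x(y)=x\triangleright y$ is a bijection of $X$, and $x\triangleright(y\triangleright z)=(x\triangleright y)\triangleright(x\triangleright z)$ for all $x,y,z$. The group of inner automorphisms $G_\psi$ is the group of bijections of $X$ generated by $\psi(X)$. The word norm on $G_\psi$ associated with $\psi(X)$ is $\|g\|_\psi=\min\{n\mid g=\psi_{x_1}^{\pm1}\cdots\psi_{x_n}^{\pm1},\ x_i\in X\}$; it is conjugation-invariant, and finite diameter means that it is bounded on $G_\psi$. The set of orbits of $G_\psi$ on $X$ (connected components) is denoted $\pi_0(X,\triangleright)$; $\pi\colon X\to\pi_0(X,\triangleright)$ is the quotient map. A (discrete) group $G$ is amenable if there is a right-invariant mean: a linear functional $\mathbf m\colon\ell^\infty(G)\to\mathbb R$ with $\mathbf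 m(1)=1$, $\mathbf m(\varphi)\ge0$ whenever $\varphi\ge0$, and $\mathbf m(\varphi\circ R_h)=\mathbf m(\varphi)$ for all $h\in G$, where $R_h(g)=gh$. $C^k_b(X;\mathbb R)$ is the space of bounded functions $f\colon X^k\to\mathbb R$, with differential $$\delta f(x_1,\dots,x_{k+1})=\sum_{i=1}^k(-1)^{i-1}f(x_1,\dots,x_{i-1},x_{i+1},\dots,x_{k+1})-\sum_{i=1}^k(-1)^{i-1}f(x_1,\dots,x_{i-1},x_i\triangleright x_{i+1},\dots,x_i\triangleright x_{k+1}),$$ and $H^*_b(X;\mathbb R)$ (rack bounded cohomology) is the cohomology of this complex. The $G_\psi$-invariant bounded cochains, i.e. those with $f(gx_1,\dots,gx_k)=f(x_1,\dots,x_k)$ for all $g\in G_\psi$, form a subcomplex $C^*_{b,\mathrm{inv}}(X;\mathbb R)$ whose cohomology is $H^*_{b,\mathrm{inv}}(X;\mathbb R)$. Given a right-invariant mean $\mathbf m$ on $G_\psi$, the projection $P\colon C^k_b(X;\mathbb R)\to C^k_{b,\mathrm{inv}}(X;\mathbb R)$ is $P(f)(x_1,\dots,x_k)=\mathbf m\big(g\mapsto f(gx_1,\dots,gx_k)\big)$; it is a morphism of complexes and the induced map on cohomology is also denoted $P$. $\operatorname{Fun}_b(\pi_0(X,\triangleright)^k,\mathbb R)$ is the space of bounded functions $\pi_0(X,\triangleright)^k\to\mathbb R$. Since $\pi$ is a morphism onto the trivial rack $\pi_0(X,\triangleright)$ (operation $a\triangleright b=b$), whose cochain differential vanishes, for each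 such function $\varphi$ the pullback $\varphi\circ(\pi\times\dots\times\pi)$ is a bounded cocycle, and $\pi^*(\varphi)$ is its class in $H^k_b(X;\mathbb R)$. *)

(* Defs.v *)
From HB Require Import structures.
From mathcomp Require Import all_boot all_order all_algebra.
From mathcomp Require Import boolp classical_sets functions reals topology.
From mathcomp Require Import normedtype.
From mathcomp Require Import zify ring.

Set Implicit Arguments.
Unset Strict Implicit.
Unset Printing Implicit Defensive.

Import Order.TTheory GRing.Theory Num.Theory.
Import numFieldNormedType.Exports.

Local Open Scope ring_scope.
Local Open Scope classical_set_scope.
Local Open Scope quotient_scope.

Section QuotientModule.
Variables (R : pzRingType) (V : lmodType R) (S : {pred V}).
Variable S_submod : subsemimod_closed S.

Definition submod_pred of subsemimod_closed S : {pred V} := S.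
HB.instance Definition _ :=
  GRing.isSubmodClosed.Build R V (submod_pred S_submod) S_submod.
Local Notation I := (submod_pred S_submod).

Definition qmod : Type := Quotient.quot I.
HB.instance Definition _ := GRing.Zmodule.on qmod.

Definition qclass (v : V) : qmod := \pi_(Quotient.quot I) v.

Lemma qclass_eq v w : (qclass v = qclass w) <-> (v - w \in S).
Proof.
rewrite -[v - w \in S]/(v - w \in I) Quotient.idealrBE.
by split=> [|/eqP//]; move/eqP.
Qed.

Lemma qclassD v w : qclass (v + w) = qclass v + qclass w.
Proof. exact: raddfD. Qed.

Lemma qclass_ind (P : qmod -> Prop) : (forall v, P (qclass v)) -> forall q, P q.
Proof. by move=> h q; rewrite -[q](@reprK _ (Quotient.quot I)); exact: h. Qed.

Lemma qclass_repr (v : V) : qclass (repr (qclass v : Quotient.quot I)) = qclass v.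
Proof. exact: (@reprK _ (Quotient.quot I)). Qed.

Definition qscale (a : R) (q : qmod) : qmod :=
  qclass (a *: repr (q : Quotient.quot I)).

Lemma qscaleE a v : qscale a (qclass v) = qclass (a *: v).
Proof.
apply/qclass_eq; rewrite -scalerBr; apply: (rpredZ (s := I)).
by apply/qclass_eq; exact: qclass_repr.
Qed.

Fact qscaleA a b q : qscale a (qscale b q) = qscale (a * b) q.
Proof. by elim/qclass_ind: q => v; rewrite !qscaleE scalerA. Qed.
Fact qscale1 : left_id 1 qscale.
Proof. by elim/qclass_ind=> v; rewrite qscaleE scale1r. Qed.
Fact qscaleDr : right_distributive qscale +%R.
Proof.
move=> a; elim/qclass_ind=> v; elim/qclass_ind=> w.
by rewrite -qclassD !qscaleE scalerDr qclassD.
Qed.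
Fact qscaleDl q : {morph qscale^~ q : a b / a + b}.
Proof.
by elim/qclass_ind: q => v a b; rewrite /= !qscaleE scalerDl qclassD.
Qed.
HB.instance Definition _ := GRing.Zmodule_isLmodule.Build R qmod
  qscaleA qscale1 qscaleDr qscaleDl.

Fact qclass_is_linear : linear qclass.
Proof. by move=> a v w; rewrite qclassD -qscaleE. Qed.
HB.instance Definition _ := GRing.isLinear.Build R V qmod _ qclass
  qclass_is_linear.
End QuotientModule.

Record cochain_complex (R : pzRingType) := CochainComplex {
  cochain :> nat -> lmodType R;
  cdiff : forall k, {linear cochain k -> cochain k.+1};
  cdiff_cdiff : forall k (c : cochain k), cdiff k.+1 (cdiff k c) = 0 }.
Arguments cdiff {R} _ {k}.

Section Cohomology.
Variables (R : pzRingType) (C : cochain_complex R) (k : nat).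

Definition is_cocycle : {pred C k} := fun c => `[< cdiff C c = 0 >].

Fact is_cocycle_submod : subsemimod_closed is_cocycle.
Proof.
split; first split; first exact/asboolP/linear0.
- by move=> u v /asboolP hu /asboolP hv; apply/asboolP; rewrite linearD hu hv addr0.
- by move=> a u /asboolP hu; apply/asboolP; rewrite linearZ /= hu scaler0.
Qed.

Record cocycles := Cocycle { cocycle_val :> C k; _ : is_cocycle cocycle_val }.
HB.instance Definition _ := [isSub for cocycle_val].
HB.instance Definition _ := [Choice of cocycles by <:].
HB.instance Definition _ := GRing.SubChoice_isSubLmodule.Build R (C k)
  is_cocycle cocycles is_cocycle_submod.
End Cohomology.

(* There are no cochains in degree -1: in degree 0 only 0 is a coboundary. *)
Definition coboundary (R : pzRingType) (C : cochain_complex R) (k : nat) :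
    C k -> Prop :=
  match k with
  | 0 => fun c => c = 0
  | j.+1 => fun c => exists b : C j, c = cdiff C b
  end.

Section Cohomology2.
Variables (R : pzRingType) (C : cochain_complex R) (k : nat).

Definition is_coboundary : {pred cocycles C k} :=
  fun z => `[< coboundary (val z) >].

Fact is_coboundary_submod : subsemimod_closed is_coboundary.
Proof.
rewrite /is_coboundary /coboundary; case: k => [|j]; (split; first split).
- exact/asboolP.
- by move=> u v /asboolP hu /asboolP hv; apply/asboolP; rewrite raddfD /= hu hv addr0.
- by move=> a u /asboolP hu; apply/asboolP; rewrite linearZ /= hu scaler0.
- by apply/asboolP; exists 0; rewrite !linear0.
- move=> u v /asboolP[b hb] /asboolP[c hc]; apply/asboolP; exists (b + c).
  by rewrite !raddfD /= hb hc.
- move=> a u /asboolP[b hb]; apply/asboolP; exists (a *: b).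
  by rewrite !linearZ /= hb.
Qed.

Definition cohomology : lmodType R := qmod is_coboundary_submod.

Definition coh_class : {linear cocycles C k -> cohomology} :=
  qclass is_coboundary_submod.

Lemma coh_class_eq (z w : cocycles C k) :
  coh_class z = coh_class w <-> is_coboundary (z - w).
Proof. exact: (qclass_eq is_coboundary_submod). Qed.

Lemma coh_class_ind (P : cohomology -> Prop) :
  (forall z, P (coh_class z)) -> forall c, P c.
Proof. exact: qclass_ind. Qed.

Definition coh_repr (c : cohomology) : cocycles C k :=
  repr (c : Quotient.quot (submod_pred is_coboundary_submod)).

Lemma coh_reprK c : coh_class (coh_repr c) = c.
Proof. exact: reprK. Qed.
End Cohomology2.
Arguments coh_class {R C k}.

Record cochain_map (R : pzRingType) (C D : cochain_complex R) := CochainMap {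
  cmap :> forall k, {linear C k -> D k};
  cmap_cdiff : forall k (c : C k), cmap k.+1 (cdiff C c) = cdiff D (cmap k c) }.

Section InducedMap.
Variables (R : pzRingType) (C D : cochain_complex R) (F : cochain_map C D).
Variable k : nat.

Fact cocycle_map_subproof (z : cocycles C k) : is_cocycle (F k (val z)).
Proof.
by case: z => c /= /asboolP hc; apply/asboolP; rewrite -cmap_cdiff hc linear0.
Qed.
Definition cocycle_map (z : cocycles C k) : cocycles D k :=
  Cocycle (cocycle_map_subproof z).

Fact cocycle_map_is_linear : linear cocycle_map.
Proof. by move=> a z w; apply: val_inj; rewrite /= !linearP. Qed.
HB.instance Definition _ := GRing.isLinear.Build R (cocycles C k)
  (cocycles D k) _ cocycle_map cocycle_map_is_linear.

Lemma cocycle_map_coboundary z : is_coboundary z -> is_coboundary (cocycle_map z).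
Proof.
move=> /asboolP hz; apply/asboolP; move: hz; case: z => c hc /=.
rewrite /coboundary; move: c hc; case: k => [c _ ->|j c _ [b ->]].
  by rewrite linear0.
by exists (F j b); rewrite cmap_cdiff.
Qed.

Definition coh_map_fun (c : cohomology C k) : cohomology D k :=
  coh_class (cocycle_map (coh_repr c)).

Lemma coh_map_funE z : coh_map_fun (coh_class z) = coh_class (cocycle_map z).
Proof.
apply/coh_class_eq; rewrite -linearB; apply: cocycle_map_coboundary.
by apply/coh_class_eq; exact: coh_reprK.
Qed.

Fact coh_map_is_linear : linear coh_map_fun.
Proof.
move=> a; elim/coh_class_ind=> z; elim/coh_class_ind=> w.
by rewrite -linearP !coh_map_funE !linearP.
Qed.
HB.instance Definition _ := GRing.isLinear.Build R (cohomology C k)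
  (cohomology D k) _ coh_map_fun coh_map_is_linear.

Definition coh_map : {linear cohomology C k -> cohomology D k} := coh_map_fun.

Lemma coh_mapE z : coh_map (coh_class z) = coh_class (cocycle_map z).
Proof. exact: coh_map_funE. Qed.
End InducedMap.

Section BoundedFunctions.
Variables (R : realType) (T : Type).

Definition is_bounded : {pred T -> R^o} := fun f => `[< bounded_fun f >].

Lemma is_boundedP (f : T -> R^o) :
  reflect (exists M, forall t, `|f t| <= M) (is_bounded f).
Proof.
apply: (iffP (asboolP _)) => [[M [_ hM]]|[M hM]].
  by exists (M + 1) => t; apply: hM; rewrite // ltrDl.
exists M; split=> [|N MN t _ /=]; first exact: num_real.
exact: le_trans (hM t) (ltW MN).
Qed.

Fact is_bounded_submod : subsemimod_closed is_bounded.
Proof.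
split; first split.
- by apply/is_boundedP; exists 0 => t; rewrite normr0.
- move=> f g /is_boundedP[M hM] /is_boundedP[N hN]; apply/is_boundedP.
  by exists (M + N) => t; apply: le_trans (ler_normD _ _) (lerD (hM t) (hN t)).
- move=> a f /is_boundedP[M hM]; apply/is_boundedP; exists (`|a| * M) => t.
  by rewrite [X in `|X|]/(a * f t) normrM ler_wpM2l.
Qed.

Record bfun := BFun { bfun_val : T -> R^o; _ : is_bounded bfun_val }.
HB.instance Definition _ := [isSub for bfun_val].
HB.instance Definition _ := [Choice of bfun by <:].
HB.instance Definition _ := GRing.SubChoice_isSubLmodule.Build R (T -> R^o)
  is_bounded bfun is_bounded_submod.

Definition bfun_app (f : bfun) : T -> R := bfun_val f.
Coercion bfun_app : bfun >-> Funclass.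

Lemma bfunP (f g : bfun) : f =1 g -> f = g.
Proof. by move=> fg; apply: val_inj; apply/funext. Qed.

Lemma bfun_bound (f : bfun) : exists M, forall t, `|f t| <= M.
Proof. exact/is_boundedP/(valP f). Qed.

Fact bcst_subproof (c : R) : is_bounded (fun=> c).
Proof. by apply/is_boundedP; exists `|c|. Qed.
Definition bcst (c : R) : bfun := BFun (bcst_subproof c).

Lemma bfunDE (f g : bfun) t : (f + g) t = f t + g t. Proof. by []. Qed.
Lemma bfunNE (f : bfun) t : (- f) t = - f t. Proof. by []. Qed.
Lemma bfunZE a (f : bfun) t : (a *: f) t = a * f t. Proof. by []. Qed.
Lemma bfun_sumE I (r : seq I) P (F : I -> bfun) t :
  (\sum_(i <- r | P i) F i) t = \sum_(i <- r | P i) F i t.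
Proof. by rewrite -[LHS]/(val _ t) raddf_sum /= fct_sumE; exact: eq_bigr. Qed.
End BoundedFunctions.
Arguments bfun_app : simpl never.

Section Precomposition.
Variables (R : realType) (S T : Type) (h : S -> T).

Fact bpre_subproof (f : bfun R T) : is_bounded (fun s => f (h s)).
Proof.
by have [M hM] := bfun_bound f; apply/is_boundedP; exists M => s; exact: hM.
Qed.
Definition bpre (f : bfun R T) : bfun R S := BFun (bpre_subproof f).

Fact bpre_is_linear : linear bpre.
Proof. by move=> a f g; exact: bfunP. Qed.
HB.instance Definition _ := GRing.isLinear.Build R (bfun R T) (bfun R S) _
  bpre bpre_is_linear.
End Precomposition.

Record right_invariant_mean (R : realType) (G : groupType) :=
  RightInvariantMean {
    mean :> {linear bfun R G -> R^o};
    mean1 : mean (bcst G 1) = 1;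
    mean_ge0 : forall f : bfun R G, (forall g, 0 <= f g) -> 0 <= mean f;
    mean_inv : forall (h : G) (f : bfun R G),
      mean (bpre (fun g => g * h)%g f) = mean f }.

Definition amenable (R : realType) (G : groupType) : Prop :=
  inhabited (right_invariant_mean R G).

Lemma mean_bound (R : realType) (G : groupType)
    (m : right_invariant_mean R G) (f : bfun R G) (M : R) :
  (forall g, `|f g| <= M) -> `|m f| <= M.
Proof.
move=> hf.
have mcst c : m (bcst G c) = c.
  have -> : bcst G c = c *: bcst G 1 by apply: bfunP => g; rewrite bfunZE mulr1.
  by rewrite linearZ /= mean1 -[LHS]/(c * 1) mulr1.
have H (u : bfun R G) : (forall g, `|u g| <= M) -> m u <= M.
  move=> hu; rewrite -subr_ge0 -{1}(mcst M) -linearB.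
  apply: mean_ge0 => g.
  by rewrite bfunDE bfunNE subr_ge0 (le_trans (ler_norm _)).
rewrite ler_norml H // andbT lerNl -linearN H // => g.
by rewrite bfunNE normrN.
Qed.

Record bijection (X : Type) := Bij { bij_fun :> X -> X; bij_bijective : bijective bij_fun }.

Section BijGroup.
Variable X : Type.
Implicit Types f g h : bijection X.

HB.instance Definition _ := gen_eqMixin (bijection X).
HB.instance Definition _ := gen_choiceMixin (bijection X).

Lemma bijP f g : f =1 g -> f = g.
Proof.
case: f g => [f hf] [g hg] /= /funext fg; case: _ / fg in hg *.
by congr Bij; exact: Prop_irrelevance.
Qed.

Definition bij1 : bijection X := Bij (Bijective (frefl id) (frefl id)).
Definition bijM f g : bijection X :=
  Bij (bij_comp (bij_bijective f) (bij_bijective g)).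

Fact bij_inv_ex f : exists g : X -> X, cancel f g /\ cancel g f.
Proof. by have [g fK gK] := bij_bijective f; exists g. Qed.
Definition bijV f : bijection X :=
  let w := cid (bij_inv_ex f) in
  Bij (Bijective (proj2 (projT2 w)) (proj1 (projT2 w))).

Fact bijMA : associative bijM. Proof. by move=> f g h; exact: bijP. Qed.
Fact bij1M : left_id bij1 bijM. Proof. by move=> f; exact: bijP. Qed.
Fact bijM1 : right_id bij1 bijM. Proof. by move=> f; exact: bijP. Qed.
Fact bijVM : left_inverse bij1 bijV bijM.
Proof. by move=> f; apply: bijP => x /=; case: cid => g []. Qed.
Fact bijMV : right_inverse bij1 bijV bijM.
Proof. by move=> f; apply: bijP => x /=; case: cid => g []. Qed.

HB.instance Definition _ := isGroup.Build (bijection X) bijMA bij1M bijM1 bijVM bijMV.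

Lemma bijME f g x : (f * g)%g x = f (g x). Proof. by []. Qed.
Lemma bij1E x : (1 : bijection X)%g x = x. Proof. by []. Qed.
End BijGroup.

HB.mixin Record isRack (X : Type) := {
  rack_op : X -> X -> X;
  rack_inhabited : inhabited X;
  rack_op_bij : forall x, bijective (rack_op x);
  rack_opDr : forall x y z,
    rack_op x (rack_op y z) = rack_op (rack_op x y) (rack_op x z) }.

#[short(type="rackType")]
HB.structure Definition Rack := {X of isRack X}.

Declare Scope rack_scope.
Notation "x |> y" := (rack_op x y)
  (at level 40, left associativity) : rack_scope.
Local Open Scope rack_scope.

Section InnerAutomorphisms.
Variable X : rackType.

Definition psi (x : X) : bijection X := Bij (rack_op_bij x).

Definition inner_set : set (bijection X) :=
  smallest (fun H : set (bijection X) => group_closed (mem H)) (range psi).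

Definition is_inner : {pred bijection X} := fun g => g \in inner_set.

Fact is_inner_group : group_closed is_inner.
Proof.
split; first by apply/mem_set => H [[H1 _] _]; exact/set_mem.
move=> f g /set_mem hf /set_mem hg; apply/mem_set => H HH; apply/set_mem.
by apply: (HH.1.2); apply/mem_set; [exact: hf | exact: hg].
Qed.

Record inner := Inner { inner_val :> bijection X; _ : is_inner inner_val }.
HB.instance Definition _ := [isSub for inner_val].
HB.instance Definition _ := [Choice of inner by <:].
HB.instance Definition _ := SubChoice_isSubGroup.Build (bijection X) is_inner inner
  is_inner_group.

Fact inner_psi_subproof (x : X) : is_inner (psi x).
Proof. by apply/mem_set; apply: sub_gen_smallest; exists x. Qed.
Definition inner_psi (x : X) : inner := Inner (inner_psi_subproof x).

Lemma innerP (f g : inner) : f =1 g -> f = g.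
Proof. by move=> fg; apply: val_inj; exact: bijP. Qed.

Lemma innerME (f g : inner) x : (f * g)%g x = f (g x). Proof. by []. Qed.
Lemma inner1E x : (1 : inner)%g x = x. Proof. by []. Qed.

(* The letter (x, false) stands for psi_x and (x, true) for its inverse. *)
Definition word_eval (w : seq (X * bool)) : inner :=
  (\prod_(l <- w) if l.2 then (inner_psi l.1)^-1 else inner_psi l.1)%g.

Lemma word_eval_nil : word_eval [::] = 1%g.
Proof. exact: big_nil. Qed.
Lemma word_eval_cons l w : word_eval (l :: w) =
  ((if l.2 then (inner_psi l.1)^-1 else inner_psi l.1) * word_eval w)%g.
Proof. exact: big_cons. Qed.
Lemma word_eval_cat u v : word_eval (u ++ v) = (word_eval u * word_eval v)%g.
Proof. exact: big_cat. Qed.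

Lemma word_eval_surj (g : inner) : exists w, g = word_eval w.
Proof.
pose H : set (bijection X) := [set f | exists w, f = val (word_eval w)].
have HV w : exists w', word_eval w' = ((word_eval w)^-1)%g.
  elim: w => [|[x b] w [w' hw']]; first by exists [::]; rewrite word_eval_nil invg1.
  exists (w' ++ [:: (x, ~~ b)]).
  rewrite word_eval_cat !word_eval_cons word_eval_nil mulg1 hw' invgM /=.
  by case: b; rewrite ?invgK.
have : inner_set (val g) by exact/set_mem/(valP g).
case/(_ H) => [|w hw]; last by exists w; exact: val_inj.
split; last first.
  by move=> _ [x _ <-]; exists [:: (x, false)]; rewrite word_eval_cons word_eval_nil mulg1.
split; first by apply/mem_set; exists [::]; rewrite word_eval_nil.
move=> _ _ /set_mem[u ->] /set_mem[v ->]; apply/mem_set.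
have [v' hv'] := HV v; exists (u ++ v').
by rewrite word_eval_cat hv'.
Qed.

Fact word_norm_subproof (g : inner) :
  exists n, `[< exists2 w, size w = n & g = word_eval w >].
Proof.
by have [w ->] := word_eval_surj g; exists (size w); apply/asboolP; exists w.
Qed.
Definition word_norm (g : inner) : nat := ex_minn (word_norm_subproof g).

Definition finite_diameter : Prop := exists N, forall g, (word_norm g <= N)%N.

Lemma inner_rack (g : inner) x y : g (x |> y) = g x |> g y.
Proof.
have [w ->] := word_eval_surj g.
elim: w x y => [|[z b] w IH] x y; first by rewrite word_eval_nil.
rewrite word_eval_cons !innerME IH.
case: b => /=; last exact: rack_opDr.
move: (word_eval w x) (word_eval w y) => {}x {}y.
have gK u : (inner_psi z) (((inner_psi z)^-1)%g u) = u.
  by rewrite -innerME mulgV.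
have gI : injective (inner_psi z) := bij_inj (bij_bijective _).
apply: gI; rewrite gK; apply/esym; apply: etrans (rack_opDr _ _ _) _.
by congr (_ |> _); exact: gK.
Qed.

Definition inner_orbit (x : X) : set X := [set y | exists g : inner, y = g x].

Definition pi0 : Type := {A : set X | exists x, A = inner_orbit x}.

Definition to_pi0 (x : X) : pi0 := exist _ (inner_orbit x) (ex_intro _ x erefl).

Lemma to_pi0_inner (g : inner) x : to_pi0 (g x) = to_pi0 x.
Proof.
apply: eq_exist; apply/seteqP; split=> y [h ->].
  by exists (h * g)%g.
by exists (h * g^-1)%g; rewrite innerME -(innerME _ g) mulVg.
Qed.
End InnerAutomorphisms.

Section Faces.
Variables (X : rackType) (k : nat).
Implicit Types (i : 'I_k.+1) (x : 'I_k.+1 -> X).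

(* Coordinates are numbered from 0; both maps delete the i-th one. *)
Definition del_face i x : 'I_k -> X := fun j => x (lift i j).
Definition act_face i x : 'I_k -> X :=
  fun j => if (j < i)%N then x (lift i j) else x i |> x (lift i j).
End Faces.

Section FaceRelations.
Variables (X : rackType) (k : nat).
Variables (i : 'I_k.+2) (j : 'I_k.+1) (i' : 'I_k.+1) (j' : 'I_k.+2).
Hypotheses (ii' : i = i'.+1 :> nat) (jj' : j = j' :> nat) (ji : (j < i)%N).
Implicit Types (x : 'I_k.+2 -> X).

Let lift_lift (l : 'I_k) : lift i (lift j l) = lift j' (lift i' l).
Proof. by apply: val_inj; rewrite /= /bump -jj'; move: ji; rewrite ii'; lia. Qed.
Let lift_j : lift i j = j'.
Proof. by apply: val_inj; rewrite /= /bump -jj'; move: ji; lia. Qed.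
Let lift_i : lift j' i' = i.
Proof. by apply: val_inj; rewrite /= /bump -jj' ii'; move: ji; rewrite ii'; lia. Qed.
Let lift_j_lt (l : 'I_k) : (lift j l < i)%N = (l < i')%N.
Proof. by rewrite /= /bump; move: ji; rewrite ii'; lia. Qed.
Let lift_i_lt (l : 'I_k) : (lift i' l < j')%N = (l < j)%N.
Proof. by rewrite /= /bump -jj'; move: ji; rewrite ii'; lia. Qed.
Let lt_i' (l : 'I_k) : (l < j)%N -> (l < i')%N.
Proof. by move: ji; rewrite ii'; lia. Qed.

Lemma del_del x : del_face j (del_face i x) = del_face i' (del_face j' x).
Proof. by apply/funext => l; rewrite /del_face lift_lift. Qed.

Lemma del_act x : del_face j (act_face i x) = act_face i' (del_face j' x).
Proof.
by apply/funext => l; rewrite /del_face /act_face lift_j_lt lift_lift lift_i.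
Qed.

Lemma act_del x : act_face j (del_face i x) = del_face i' (act_face j' x).
Proof.
by apply/funext => l; rewrite /del_face /act_face lift_i_lt lift_lift lift_j.
Qed.

Lemma act_act x : act_face j (act_face i x) = act_face i' (act_face j' x).
Proof.
apply/funext => l; rewrite /act_face !lift_j_lt lift_i_lt lift_lift lift_i lift_j.
have -> : (j < i)%N by []; have -> : (i' < j')%N = false.
  by rewrite -jj'; move: ji; rewrite ii'; lia.
case: (ltnP l j) => [/lt_i' -> //|_]; case: ltnP => // _.
by rewrite rack_opDr.
Qed.
End FaceRelations.

Lemma alternating_sum0 (V : comPzRingType) (k : nat) (F : nat -> nat -> V) :
    (forall i j, (j < i <= k)%N -> F i j = F j i.-1) ->
  \sum_(i < k.+1) \sum_(j < k) (-1) ^+ i * ((-1) ^+ j * F i j) = 0.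
Proof.
elim: k => [|k IH] hF; first by rewrite big_ord1 big_ord0.
rewrite big_ord_recr /=.
under eq_bigr do rewrite big_ord_recr /=.
rewrite big_split /= IH => [|i j /andP[ji ik]]; last first.
  by apply: hF; rewrite ji ltnW.
rewrite add0r -big_split /= big1 // => i _.
by rewrite (hF k.+1 i) /= ?leqnn ?andbT// exprS; ring.
Qed.

Section RackComplex.
Variables (R : realType) (X : rackType).

(* The faces of index k, the last one, are left out: they coincide. *)
Definition delta k (f : bfun R ('I_k -> X)) : bfun R ('I_k.+1 -> X) :=
  \sum_(i < k) (-1) ^+ i *: bpre (del_face (widen_ord (leqnSn k) i)) f
  - \sum_(i < k) (-1) ^+ i *: bpre (act_face (widen_ord (leqnSn k) i)) f.

Lemma deltaE k (f : bfun R ('I_k -> X)) x :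
  delta f x = \sum_(i < k) (-1) ^+ i *
    (f (del_face (widen_ord (leqnSn k) i) x)
     - f (act_face (widen_ord (leqnSn k) i) x)).
Proof.
rewrite bfunDE bfunNE !bfun_sumE -sumrB; apply: eq_bigr => i _.
by rewrite [RHS]mulrBr.
Qed.

Fact delta_is_linear k : linear (@delta k).
Proof.
move=> a f g; apply: bfunP => x.
suff: delta (a *: f + g) x = a * delta f x + delta g x by [].
rewrite !deltaE mulr_sumr -big_split /=; apply: eq_bigr => i _.
by rewrite !bfunDE !bfunZE; ring.
Qed.
HB.instance Definition _ k := GRing.isLinear.Build R (bfun R ('I_k -> X))
  (bfun R ('I_k.+1 -> X)) _ (@delta k) (@delta_is_linear k).

Fact delta_delta k (f : bfun R ('I_k -> X)) : delta (delta f) = 0.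
Proof.
apply: bfunP => x; rewrite [RHS]/(0 : R).
case: k f x => [|k] f x; first by rewrite deltaE big_ord1 !deltaE !big_ord0 subrr mulr0.
pose D n i y := @del_face X n (inord i) y.
pose A n i y := @act_face X n (inord i) y.
pose F i j := f (D k.+1 j (D k.+2 i x)) - f (A k.+1 j (D k.+2 i x))
  - (f (D k.+1 j (A k.+2 i x)) - f (A k.+1 j (A k.+2 i x))).
have wi n (i : 'I_n) : widen_ord (leqnSn n) i = inord i.
  by apply: val_inj; rewrite /= inordK // ltnS ltnW.
rewrite -[RHS](@alternating_sum0 _ k.+1 F) => [|i j /andP[ji ik]].
  rewrite deltaE; apply: eq_bigr => i _; rewrite !deltaE -sumrB mulr_sumr.
  by apply: eq_bigr => j _; rewrite !wi /F /D /A; ring.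
have [j_lt i_lt] : (j < k.+2)%N /\ (i < k.+3)%N by lia.
have E1 : (@inord k.+2 i) = (@inord k.+1 i.-1).+1 :> nat.
  by rewrite !inordK //; lia.
have E2 : (@inord k.+1 j) = (@inord k.+2 j) :> nat by rewrite !inordK //; lia.
have E3 : (@inord k.+1 j < @inord k.+2 i)%N by rewrite !inordK.
rewrite /F /D /A (del_del E1 E2 E3) (del_act E1 E2 E3) (act_del E1 E2 E3).
rewrite (act_act E1 E2 E3); ring.
Qed.

Definition bounded_complex : cochain_complex R := @CochainComplex R
  (fun k => bfun R ('I_k -> X)) (fun k => @delta k) (fun k => @delta_delta k).
End RackComplex.

Section InvariantComplex.
Variables (R : realType) (X : rackType).

Lemma inner_del_face k (g : inner X) (i : 'I_k.+1) (x : 'I_k.+1 -> X) :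
  del_face i (g \o x) = g \o del_face i x.
Proof. by []. Qed.

Lemma inner_act_face k (g : inner X) (i : 'I_k.+1) (x : 'I_k.+1 -> X) :
  act_face i (g \o x) = g \o act_face i x.
Proof.
by apply/funext => j; rewrite /act_face /=; case: ifP => // _; rewrite inner_rack.
Qed.

Definition is_invariant k : {pred bfun R ('I_k -> X)} :=
  fun f => `[< forall (g : inner X) x, f (g \o x) = f x >].

Fact is_invariant_submod k : subsemimod_closed (@is_invariant k).
Proof.
split; first split; first exact/asboolP.
- move=> u v /asboolP hu /asboolP hv; apply/asboolP => g x.
  by rewrite !bfunDE hu hv.
- by move=> a u /asboolP hu; apply/asboolP => g x; rewrite !bfunZE hu.
Qed.

Record ibfun k := IBFun {
  ibfun_val : bfun R ('I_k -> X); _ : is_invariant ibfun_val }.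
HB.instance Definition _ k := [isSub for @ibfun_val k].
HB.instance Definition _ k := [Choice of ibfun k by <:].
HB.instance Definition _ k := GRing.SubChoice_isSubLmodule.Build R
  (bfun R ('I_k -> X)) (@is_invariant k) (ibfun k) (@is_invariant_submod k).

Fact idelta_subproof k (f : ibfun k) : is_invariant (delta (val f)).
Proof.
case: f => f /= /asboolP hf; apply/asboolP => g x; rewrite !deltaE.
by apply: eq_bigr => i _; rewrite inner_del_face inner_act_face !hf.
Qed.
Definition idelta k (f : ibfun k) : ibfun k.+1 := IBFun (idelta_subproof f).

Fact idelta_is_linear k : linear (@idelta k).
Proof. by move=> a f g; apply: val_inj; rewrite /= !linearP. Qed.
HB.instance Definition _ k := GRing.isLinear.Build R (ibfun k) (ibfun k.+1) _
  (@idelta k) (@idelta_is_linear k).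

Fact idelta_idelta k (f : ibfun k) : idelta (idelta f) = 0.
Proof. by apply: val_inj; exact: delta_delta. Qed.

Definition invariant_complex : cochain_complex R := @CochainComplex R
  (fun k => ibfun k) (fun k => @idelta k) (fun k => @idelta_idelta k).
End InvariantComplex.

Section Projection.
Variables (R : realType) (X : rackType) (m : right_invariant_mean R (inner X)).
Variable k : nat.

Fact proj_bounded (f : bfun R ('I_k -> X)) :
  is_bounded (fun x : 'I_k -> X => m (bpre (fun g : inner X => g \o x) f)).
Proof.
have [M hM] := bfun_bound f; apply/is_boundedP; exists M => x.
by apply: mean_bound => g; exact: hM.
Qed.

Fact proj_invariant (f : bfun R ('I_k -> X)) :
  is_invariant (BFun (proj_bounded f)).
Proof.
apply/asboolP => h x; rewrite /bfun_app /=.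
by rewrite -[RHS](mean_inv m h); congr (m _); exact: bfunP.
Qed.

Definition proj (f : bounded_complex R X k) : invariant_complex R X k :=
  IBFun (proj_invariant f).

Fact proj_is_linear : linear proj.
Proof.
move=> a f g; apply: val_inj; apply: bfunP => x.
pose e := @bpre R _ _ (fun h : inner X => h \o x).
apply: etrans (linearP m a (e f) (e g)); congr (m _); exact: bfunP.
Qed.
HB.instance Definition _ := GRing.isLinear.Build R (bounded_complex R X k)
  (invariant_complex R X k) _ proj proj_is_linear.
End Projection.

Section ProjectionMap.
Variables (R : realType) (X : rackType) (m : right_invariant_mean R (inner X)).

Fact proj_cdiff k (f : bounded_complex R X k) :
  proj m (cdiff (bounded_complex R X) f) =
  cdiff (invariant_complex R X) (proj m f).
Proof.
apply: val_inj; apply: bfunP => x.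
pose e n (y : 'I_n -> X) := @bpre R _ _ (fun h : inner X => h \o y).
rewrite -[LHS]/(m (e _ x (delta f))) -[RHS]/(delta (val (proj m f)) x) deltaE.
have -> : e _ x (delta f) = \sum_(i < k) (-1) ^+ i *:
    (e _ (del_face (widen_ord (leqnSn k) i) x) f
     - e _ (act_face (widen_ord (leqnSn k) i) x) f).
  apply: bfunP => g; rewrite bfun_sumE -[LHS]/(delta f (g \o x)) deltaE.
  apply: eq_bigr => i _.
  by rewrite inner_del_face inner_act_face.
rewrite linear_sum; apply: eq_bigr => i _.
by rewrite linearZ /= linearB.
Qed.

Definition projection :
    cochain_map (bounded_complex R X) (invariant_complex R X) :=
  @CochainMap R (bounded_complex R X) (invariant_complex R X)
    (fun k => @proj R X m k) proj_cdiff.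
End ProjectionMap.

Section Pullback.
Variables (R : realType) (X : rackType) (k : nat).

Definition pullback (phi : bfun R ('I_k -> pi0 X)) : bounded_complex R X k :=
  bpre (fun x : 'I_k -> X => @to_pi0 X \o x) phi.

Fact pullback_cocycle phi : is_cocycle (pullback phi).
Proof.
apply/asboolP; apply: bfunP => x.
rewrite -[LHS]/(delta (bpre (fun x : 'I_k -> X => @to_pi0 X \o x) phi) x) deltaE.
rewrite big1 // => i _; rewrite -[X in _ * (_ - X)]/(phi (_ \o _)).
rewrite -[X in _ * (X - _)]/(phi (_ \o _)).
suff -> : @to_pi0 X \o act_face (widen_ord (leqnSn k) i) x =
          @to_pi0 X \o del_face (widen_ord (leqnSn k) i) x.
  by rewrite subrr mulr0.
apply/funext => j; rewrite /act_face /del_face /=; case: ifP => // _.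
exact: (to_pi0_inner (inner_psi _)).
Qed.

Definition pullback_cocycles phi : cocycles (bounded_complex R X) k :=
  Cocycle (pullback_cocycle phi).

Fact pullback_is_linear : linear pullback_cocycles.
Proof. by move=> a f g; apply: val_inj; exact: bfunP. Qed.
HB.instance Definition _ := GRing.isLinear.Build R (bfun R ('I_k -> pi0 X))
  (cocycles (bounded_complex R X) k) _ pullback_cocycles pullback_is_linear.

Definition pi_star :
    {linear bfun R ('I_k -> pi0 X) -> cohomology (bounded_complex R X) k} :=
  coh_class \o pullback_cocycles.
End Pullback.

Definition lmod_isomorphic (R : pzRingType) (U V : lmodType R) : Prop :=
  exists f : {linear U -> V}, bijective f.

(* Main.v *)
(* Evaluating the first variable at [x] is a chain homotopy between the identity
   and the translation by [psi x].  Composing these along words of bounded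
   length gives homotopies between the identity and all translations by inner
   automorphisms, with a uniform bound; averaging them shows that a cocycle is
   cohomologous to its projection.  For an invariant cochain the translation
   terms cancel, so that [f(x, _)] is a cocycle whenever [f] is an invariant
   cocycle, and the coboundary of an invariant [F] restricts to that of
   [- F(x, _)].  By induction on the degree, [f(x, _)] is then a pullback from
   [pi0] plus a coboundary, with bounds uniform in [x]; averaging over the group
   makes both terms invariant in [x], and they reassemble into [f]. *)
From HB Require Import structures.
Require Import Defs.
From mathcomp Require Import all_boot all_algebra reals.
From mathcomp Require Import order boolp classical_sets functions.
From mathcomp Require Import lra.

Set Implicit Arguments.
Unset Strict Implicit.
Unset Printing Implicit Defensive.

Import Order.TTheory GRing.Theory Num.Theory.

Local Open Scope ring_scope.

(** * Tuples with the first entry split off *)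

Section FinCons.
Variables (T : Type) (k : nat).

Definition fcons (x : T) (y : 'I_k -> T) : 'I_k.+1 -> T :=
  fun i => if unlift ord0 i is Some j then y j else x.

Lemma fcons0 x y : fcons x y ord0 = x.
Proof. by rewrite /fcons unlift_none. Qed.

Lemma fcons_lift x y j : fcons x y (lift ord0 j) = y j.
Proof. by rewrite /fcons liftK. Qed.

Lemma fcons_eta z : z = fcons (z ord0) (z \o lift ord0).
Proof.
apply/funext => i; case: (unliftP ord0 i) => [j|] ->.
  by rewrite fcons_lift.
by rewrite fcons0.
Qed.

Lemma fcons_ind (P : ('I_k.+1 -> T) -> Prop) :
  (forall x y, P (fcons x y)) -> forall z, P z.
Proof. by move=> h z; rewrite (fcons_eta z). Qed.
End FinCons.

Lemma comp_fcons (S T : Type) k (h : S -> T) x (y : 'I_k -> S) :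
  h \o fcons x y = fcons (h x) (h \o y).
Proof.
rewrite [LHS]fcons_eta /= fcons0; congr fcons.
by apply/funext => j /=; rewrite fcons_lift.
Qed.

(** * Uniformly bounded families of functions *)

Section BoundedFamilies.
Variables (R : realType) (I T : Type).

(** Primitives are chosen index by index, with no relation between them. A common bound is what lets
    them be glued into one bounded function, to which a mean applies. *)
Lemma bfun_uncurry (F : I -> bfun R T) (M : R) :
    (forall i t, `|F i t| <= M) ->
  exists2 G : bfun R (I * T), forall i t, G (i, t) = F i t
    & forall u, `|G u| <= M.
Proof.
move=> hF; have bG : is_bounded (fun u : I * T => F u.1 u.2 : R^o).
  by apply/is_boundedP; exists M => -[i t]; exact: hF.
by exists (BFun bG) => // -[i t]; exact: hF.
Qed.
End BoundedFamilies.

(** * Faces of a tuple with an entry in front *)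

Section Faces.
Variables (X : rackType) (k : nat).
Implicit Types (x : X) (y : 'I_k.+1 -> X).

Lemma del_face_fcons0 x y : del_face ord0 (fcons x y) = y.
Proof. by apply/funext => j; rewrite /del_face fcons_lift. Qed.

Lemma act_face_fcons0 x y : act_face ord0 (fcons x y) = psi x \o y.
Proof. by apply/funext => j; rewrite /act_face /= fcons_lift fcons0. Qed.

Lemma lift_lift0 n (i : 'I_n.+1) (j : 'I_n) :
  lift (lift ord0 i) (lift ord0 j) = lift ord0 (lift i j).
Proof. by apply: val_inj; rewrite /= /bump /= !add1n ltnS addnS. Qed.

Lemma lift_lift_ord0 n (i : 'I_n.+1) :
  lift (lift ord0 i) ord0 = ord0.
Proof. exact: val_inj. Qed.

Lemma del_face_fcons x y i :
  del_face (lift ord0 i) (fcons x y) = fcons x (del_face i y).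
Proof.
rewrite [LHS]fcons_eta /del_face /= lift_lift_ord0 fcons0; congr fcons.
by apply/funext => j /=; rewrite lift_lift0 fcons_lift.
Qed.

(** Face [i + 1] acts only on the coordinates after its own, so the entry in front is untouched. *)
Lemma act_face_fcons x y i :
  act_face (lift ord0 i) (fcons x y) = fcons x (act_face i y).
Proof.
rewrite [LHS]fcons_eta /act_face /= lift_lift_ord0 fcons0; congr fcons.
by apply/funext => j /=; rewrite lift_lift0 !fcons_lift /bump /= !add1n ltnS.
Qed.
End Faces.

Lemma bfun0E (R : realType) (T : Type) (t : T) : (0 : bfun R T) t = 0.
Proof. by []. Qed.

(** * Translations by inner automorphisms are homotopic to the identity *)

Section Homotopy.
Variables (R : realType) (X : rackType).

Lemma delta_degree0 (f : bfun R ('I_0 -> X)) : delta f = 0.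
Proof. by apply: bfunP => x; rewrite deltaE big_ord0. Qed.

(** The homotopy formula. Face 0 removes [x], with or without acting by it; the other faces keep [x]
    in front, and the shift of their index by one produces the minus sign. *)
Lemma delta_fcons k (f : bfun R ('I_k.+1 -> X)) x y :
  delta f (fcons x y) =
  f y - f (psi x \o y) - delta (bpre (fcons x) f) y.
Proof.
have w0 : widen_ord (leqnSn k.+1) ord0 = ord0 by exact: val_inj.
rewrite !deltaE big_ord_recl w0 expr0 mul1r del_face_fcons0 act_face_fcons0.
congr (_ + _); rewrite -sumrN; apply: eq_bigr => i _.
have -> : widen_ord (leqnSn k.+1) (lift ord0 i) =
          lift ord0 (widen_ord (leqnSn k) i) by exact: val_inj.
rewrite del_face_fcons act_face_fcons /= exprS mulN1r mulNr.
by [].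
Qed.

Definition translate k (g : inner X) (f : bfun R ('I_k -> X)) :=
  bpre (fun x : 'I_k -> X => g \o x) f.

Lemma delta_translate k g (f : bfun R ('I_k -> X)) :
  delta (translate g f) = translate g (delta f).
Proof.
apply: bfunP => x; rewrite deltaE -[RHS]/(delta f (g \o x)) deltaE.
by apply: eq_bigr => i _; rewrite inner_del_face inner_act_face.
Qed.

Lemma translateM k g h (f : bfun R ('I_k -> X)) :
  translate (g * h)%g f = translate h (translate g f).
Proof. exact: bfunP. Qed.

Lemma translate1 k (f : bfun R ('I_k -> X)) : translate 1%g f = f.
Proof. exact: bfunP. Qed.

Lemma translateD k g (e f : bfun R ('I_k -> X)) :
  translate g (e + f) = translate g e + translate g f.
Proof. exact: bfunP. Qed.

Lemma translate_letter k (l : X * bool) (f : bfun R ('I_k.+1 -> X)) (M : R) :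
    delta f = 0 -> (forall x, `|f x| <= M) ->
  exists2 b : bfun R ('I_k -> X), forall x, `|b x| <= M &
    translate (word_eval [:: l]) f = f + delta b.
Proof.
case: l => x s df0 fM; rewrite word_eval_cons word_eval_nil mulg1 /=.
pose b : bfun R ('I_k -> X) := - bpre (fcons x) f.
have bM y : `|b y| <= M by rewrite bfunNE normrN; exact: fM.
have tf : translate (inner_psi x) f = f + delta b.
  apply: bfunP => y; rewrite bfunDE /b linearN bfunNE.
  have := congr1 (fun u : bfun R _ => u (fcons x y)) df0.
  rewrite delta_fcons -[RHS]/(0 : R).
  by rewrite -[translate _ _ _]/(f (psi x \o y)) => ?; lra.
case: s; last by exists b.
(* For an inverse letter, translate the identity [tf] by that inverse and solve for the translate of
   [f]; precomposition preserves the bound. *)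
exists (- translate (inner_psi x)^-1%g b).
  by move=> y; rewrite bfunNE normrN; exact: bM.
rewrite linearN /= delta_translate.
have := congr1 (translate (inner_psi x)^-1%g) tf.
rewrite -translateM mulgV translate1 translateD => {2}->.
by rewrite addrK.
Qed.

(** Translation is a right action commuting with [delta], so the primitive of the first letter is
    translated by the rest of the word. Each letter costs one [M]. *)
Lemma translate_word k w (f : bfun R ('I_k.+1 -> X)) (M : R) :
    delta f = 0 -> (forall x, `|f x| <= M) ->
  exists2 b : bfun R ('I_k -> X), forall x, `|b x| <= M *+ size w &
    translate (word_eval w) f = f + delta b.
Proof.
move=> df0 fM; elim: w => [|l w [b bM wf]].
  exists 0; first by move=> x; rewrite normr0.
  by rewrite word_eval_nil translate1 linear0 addr0.
have [c cM lf] := translate_letter l df0 fM.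
exists (translate (word_eval w) c + b).
  move=> x; rewrite bfunDE mulrS; apply: le_trans (ler_normD _ _) _.
  by apply: lerD; [exact: cM | exact: bM].
rewrite -cat1s word_eval_cat translateM lf translateD -delta_translate wf.
by rewrite linearD /= addrAC -addrA.
Qed.

Lemma translate_inner k (N : nat) (g : inner X) (f : bfun R ('I_k.+1 -> X))
    (M : R) :
    (word_norm g <= N)%N -> delta f = 0 -> (forall x, `|f x| <= M) ->
  exists2 b : bfun R ('I_k -> X), forall x, `|b x| <= M *+ N &
    translate g f = f + delta b.
Proof.
rewrite /word_norm; case: ex_minnP => n /asboolP[w <- ->] _ wN df0 fM.
have [b bM ->] := translate_word w df0 fM; exists b => // x.
apply: le_trans (bM x) _.
(* Passing from [size w] to [N] needs [M] nonnegative, which holds because a rack, hence the set of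
   tuples, is non-empty. *)
rewrite -[_ *+ size w]mulr_natr -[_ *+ N]mulr_natr ler_wpM2l ?ler_nat //.
have [a] := @rack_inhabited X.
exact: le_trans (normr_ge0 _) (fM (fun=> a)).
Qed.
End Homotopy.

(** * Averaging bounded functions with a parameter in the group *)

Section Average.
Variables (R : realType) (G : groupType) (m : right_invariant_mean R G).

Lemma mean_cst c : m (bcst G c) = c.
Proof.
have -> : bcst G c = c *: bcst G 1 by apply: bfunP => g; rewrite bfunZE mulr1.
by rewrite linearZ /= mean1 -[LHS]/(c * 1) mulr1.
Qed.

Section AverageDef.
Variable T : Type.
Implicit Type B : bfun R (G * T).

Fact average_subproof B :
  is_bounded (fun t => m (bpre (fun g => (g, t)) B)).
Proof.
have [M hM] := bfun_bound B; apply/is_boundedP; exists M => t.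
by apply: mean_bound => g; exact: hM.
Qed.
Definition average B : bfun R T := BFun (average_subproof B).

Lemma averageE B t : average B t = m (bpre (fun g => (g, t)) B).
Proof. by []. Qed.

Lemma average_bound B (M : R) :
  (forall u, `|B u| <= M) -> forall t, `|average B t| <= M.
Proof. by move=> hB t; apply: mean_bound => g; exact: hB. Qed.
End AverageDef.
End Average.

(** * The projection to invariant cochains, up to bounded homotopy *)

Section Projection.
Variables (R : realType) (X : rackType) (m : right_invariant_mean R (inner X)).

(** At each tuple [delta] is a finite linear combination of values, so the mean commutes with it.
    The family [D] is passed separately because [delta] acts on the second variable of [B] only. *)
Lemma delta_average k (B : bfun R (inner X * ('I_k -> X)))
    (D : bfun R (inner X * ('I_k.+1 -> X))) :
    (forall g x, D (g, x) = delta (bpre (pair g) B) x) ->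
  average m D = delta (average m B).
Proof.
move=> DB; apply: bfunP => x; rewrite deltaE.
pose e (y : 'I_k -> X) : bfun R (inner X) := bpre (fun g => (g, y)) B.
rewrite averageE.
have -> : bpre (fun g => (g, x)) D = \sum_(i < k) (-1) ^+ i *:
    (e (del_face (widen_ord (leqnSn k) i) x)
     - e (act_face (widen_ord (leqnSn k) i) x)).
  apply: bfunP => g; rewrite bfun_sumE -[LHS]/(D (g, x)) DB deltaE.
  by apply: eq_bigr => i _.
rewrite linear_sum; apply: eq_bigr => i _.
by rewrite linearZ /= linearB.
Qed.

(** The projection with its target read back among all bounded cochains, so that it can be compared
    with [f] itself. *)
Definition invproj k (f : bfun R ('I_k -> X)) : bfun R ('I_k -> X) :=
  ibfun_val (proj m (f : bounded_complex R X k)).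

Lemma invprojE k (f : bfun R ('I_k -> X)) x :
  invproj f x = m (bpre (fun g : inner X => g \o x) f).
Proof. by []. Qed.

Lemma invproj_inv k (f : bfun R ('I_k -> X)) (g : inner X) x :
  invproj f (g \o x) = invproj f x.
Proof. by rewrite /invproj; case: (proj m _) => /= p /asboolP. Qed.

Lemma invproj_id k (f : bfun R ('I_k -> X)) :
  (forall (g : inner X) x, f (g \o x) = f x) -> invproj f = f.
Proof.
move=> finv; apply: bfunP => x; rewrite invprojE -[RHS](mean_cst m).
by congr (m _); apply: bfunP => g; exact: finv.
Qed.

Lemma delta_invproj k (f : bfun R ('I_k -> X)) :
  delta (invproj f) = invproj (delta f).
Proof. exact: (congr1 (@ibfun_val _ _ _) (esym (proj_cdiff m f))). Qed.

Lemma invproj_bound k (f : bfun R ('I_k -> X)) (M : R) :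
  (forall x, `|f x| <= M) -> forall x, `|invproj f x| <= M.
Proof. by move=> fM x; apply: mean_bound => g; exact: fM. Qed.

Lemma invproj_cohomologous k (N : nat) (f : bfun R ('I_k.+1 -> X)) (M : R) :
    (forall g : inner X, (word_norm g <= N)%N) ->
    delta f = 0 -> (forall x, `|f x| <= M) ->
  exists2 b : bfun R ('I_k -> X), forall x, `|b x| <= M *+ N &
    invproj f = f + delta b.
Proof.
move=> normN df0 fM.
have /choice[b hb] : forall g : inner X, exists b : bfun R ('I_k -> X),
    (forall x, `|b x| <= M *+ N) /\ translate g f = f + delta b.
  move=> g; have [b bM fb] := translate_inner (normN g) df0 fM.
  by exists b.
have [B Bb BM] := bfun_uncurry (fun g => (hb g).1).
exists (average m B); first exact: average_bound BM.
(* [D] collects the differences between the translates of [f] and [f], which are the coboundaries of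
   the [b g]; its average is [invproj f - f]. *)
have [D Df _] : exists2 D : bfun R (inner X * ('I_k.+1 -> X)),
    forall g x, D (g, x) = (translate g f - f) x & forall u, `|D u| <= M + M.
  apply: bfun_uncurry => g x; rewrite bfunDE bfunNE.
  by apply: le_trans (ler_normB _ _) (lerD _ _); exact: fM.
have <- : average m D = delta (average m B).
  apply: delta_average => g x; rewrite Df (hb g).2 addrC addKr.
  by congr (delta _ x); apply: bfunP => y; rewrite -Bb.
apply: bfunP => x; rewrite bfunDE averageE.
rewrite -[X in X + _](mean_cst m) -linearD invprojE; congr (m _).
apply: bfunP => g; rewrite bfunDE -[bpre _ D g]/(D (g, x)) Df bfunDE bfunNE.
rewrite -[bcst _ _ _]/(f x) [LHS]/(f (g \o x)).
by rewrite -[translate g f x]/(f (g \o x)) addrC subrK.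
Qed.

(** Invariance cancels the translation term of [delta_fcons]. This lowers the degree in both
    inductions below. *)
Lemma delta_invproj_fcons k (b : bfun R ('I_k.+1 -> X)) x y :
  delta (invproj b) (fcons x y) = - delta (bpre (fcons x) (invproj b)) y.
Proof.
by rewrite delta_fcons (invproj_inv b (inner_psi x)) subrr add0r.
Qed.
End Projection.

(** * Representatives of connected components *)

Section Pi0.
Variable X : rackType.

Definition pi0_repr (a : pi0 X) : X := projT1 (cid (proj2_sig a)).

Lemma pi0_reprK : cancel pi0_repr (@to_pi0 X).
Proof.
by case=> A hA; apply: eq_exist; rewrite /pi0_repr; case: cid => x /= ->.
Qed.

(** Components are orbits as sets, so equality of components transports the membership of the
    representative in its own orbit. *)
Lemma pi0_repr_inner x : exists g : inner X, pi0_repr (to_pi0 x) = g x.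
Proof.
have : inner_orbit x (pi0_repr (to_pi0 x)); last by [].
have [<-] : to_pi0 (pi0_repr (to_pi0 x)) = to_pi0 x by rewrite pi0_reprK.
by exists 1%g.
Qed.

Lemma comp_pi0_reprK k (a : 'I_k -> pi0 X) :
  @to_pi0 X \o (pi0_repr \o a) = a.
Proof. by apply/funext => i; exact: pi0_reprK. Qed.
End Pi0.

(** * Pullbacks from the components represent each class exactly once *)

Section PullbackCohomology.
Variables (R : realType) (X : rackType) (m : right_invariant_mean R (inner X)).

Lemma pullbackE k (phi : bfun R ('I_k -> pi0 X)) (x : 'I_k -> X) :
  bfun_app (pullback phi) x = phi (@to_pi0 X \o x).
Proof. by []. Qed.

Lemma invproj_pullback k (phi : bfun R ('I_k -> pi0 X)) :
  invproj m (pullback phi) = pullback phi.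
Proof.
apply: invproj_id => g x; rewrite !pullbackE; congr (phi _).
by apply/funext => i; exact: to_pi0_inner.
Qed.

(** A pullback is invariant, so [b] may be replaced by its average; fixing the first variable then
    gives the same situation one degree lower. In degree 1 every coboundary vanishes. *)
Lemma pullback_coboundary0 k (phi : bfun R ('I_k.+1 -> pi0 X))
    (b : bfun R ('I_k -> X)) :
  pullback phi = delta b -> phi = 0.
Proof.
elim: k phi b => [|k IH] phi b phib; apply: bfunP => a.
  by rewrite -(comp_pi0_reprK a) -pullbackE phib delta_degree0.
rewrite -(comp_pi0_reprK a); move: (_ \o a); elim/fcons_ind => x y.
have {}phib : pullback phi = delta (invproj m b).
  by rewrite delta_invproj -phib invproj_pullback.
pose phi_x : bfun R ('I_k.+1 -> pi0 X) := bpre (fcons (to_pi0 x)) phi.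
have /IH phi_x0 : pullback phi_x = delta (- bpre (fcons x) (invproj m b)).
  apply: bfunP => z; rewrite linearN bfunNE -delta_invproj_fcons -phib.
  by rewrite !pullbackE comp_fcons.
rewrite comp_fcons -[LHS]/(phi_x (@to_pi0 X \o y)).
by rewrite phi_x0.
Qed.

(** [C] is chosen before [f]: the induction hypothesis is applied to all restrictions [f0(x, _)] at
    once, and their decompositions must be uniformly bounded in [x] to be glued. *)
Lemma cocycle_pullback (N k : nat) (M : R) :
    (forall g : inner X, (word_norm g <= N)%N) ->
  exists C : R, forall f : bfun R ('I_k.+1 -> X),
    delta f = 0 -> (forall x, `|f x| <= M) ->
    exists phi : bfun R ('I_k.+1 -> pi0 X), exists b : bfun R ('I_k -> X),
      [/\ forall a, `|phi a| <= C, forall y, `|b y| <= C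
        & f = pullback phi + delta b].
Proof.
move=> normN; elim: k => [|k [C IH]].
  exists M => f df0 fM.
  exists (bpre (fun a : 'I_1 -> pi0 X => @pi0_repr X \o a) f), 0.
  split=> [a|y|]; first exact: fM.
    rewrite normr0; have [a] := @rack_inhabited X.
    exact: le_trans (normr_ge0 _) (fM (fun=> a)).
  rewrite linear0 addr0; apply: bfunP => x.
  rewrite -[RHS]/(f (@pi0_repr X \o (@to_pi0 X \o x))).
  have [g gx] := pi0_repr_inner (x ord0).
  have -> : @pi0_repr X \o (@to_pi0 X \o x) = g \o x.
    by apply/funext => i; rewrite ord1 /= gx.
  (* In degree 1 the primitive lives in degree 0, where [delta] is zero, so the cocycle itself is
     invariant and depends only on the component. *)
  have [b _ fb] := translate_inner (normN g) df0 fM.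
  have := congr1 (fun u : bfun R _ => u x) fb.
  by rewrite /= delta_degree0 addr0.
(* [M *+ N] bounds the primitive between [f] and its average. [C] serves the restrictions of the
   average, which keeps the bound [M]. *)
exists (M *+ N + C) => f df0 fM.
have [c cM fc] := invproj_cohomologous m normN df0 fM.
have PfM := invproj_bound m fM.
have dPf : delta (invproj m f) = 0.
  by rewrite delta_invproj df0; exact: (congr1 (@ibfun_val _ _ _) (linear0 _)).
set f0 := invproj m f in fc PfM dPf.
have f0_inv (g : inner X) x : f0 (g \o x) = f0 x by exact: invproj_inv.
have /choice[p hp] : forall x : X, exists p : bfun R ('I_k.+1 -> pi0 X) *
    bfun R ('I_k -> X), [/\ forall a, `|p.1 a| <= C, forall y, `|p.2 y| <= C
      & bpre (fcons x) f0 = pullback p.1 + delta p.2].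
  move=> x; have [|y|phi [b hb]] := IH (bpre (fcons x) f0).
  - apply: bfunP => y.
    have := congr1 (fun u : bfun R _ => u (fcons x y)) dPf.
    rewrite delta_fcons (f0_inv (inner_psi x)) subrr add0r !bfun0E => /eqP.
    by rewrite oppr_eq0 => /eqP.
  - exact: PfM.
  - by exists (phi, b).
have [Phi PhiE PhiC] : exists2 Phi : bfun R (X * ('I_k.+1 -> pi0 X)),
    forall x a, Phi (x, a) = (p x).1 a & forall u, `|Phi u| <= C.
  by apply: bfun_uncurry => x a; have [] := hp x.
have [B0 B0E B0C] : exists2 B : bfun R (X * ('I_k -> X)),
    forall x y, B (x, y) = (p x).2 y & forall u, `|B u| <= C.
  by apply: bfun_uncurry => x y; have [] := hp x.
pose B : bfun R ('I_k.+1 -> X) :=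
  bpre (fun z : 'I_k.+1 -> X => (z ord0, z \o lift ord0)) B0.
have BE x y : B (fcons x y) = (p x).2 y.
  rewrite -B0E -[LHS]/(B0 (_, _)) fcons0; congr (B0 (_, _)).
  by apply/funext => i /=; rewrite fcons_lift.
(* The mean over [g] of [Phi] at [g] applied to a representative of the first component; right
   invariance will make the choice of representative irrelevant. *)
pose phi : bfun R ('I_k.+2 -> pi0 X) := average m
  (bpre (fun u : inner X * ('I_k.+2 -> pi0 X) =>
     (u.1 (pi0_repr (u.2 ord0)), u.2 \o lift ord0)) Phi).
have M0 : 0 <= M *+ N.
  have [a] := @rack_inhabited X.
  exact: le_trans (normr_ge0 _) (cM (fun=> a)).
exists phi, (- c - invproj m B); split=> [a|y|].
- apply: le_trans (_ : C <= _); last by rewrite lerDr.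
  by apply: average_bound => u; exact: PhiC.
- rewrite bfunDE !bfunNE; apply: le_trans (ler_normB _ _) _.
  rewrite normrN lerD //; apply: invproj_bound => z; exact: B0C.
suff f0E : f0 = pullback phi - delta (invproj m B).
  by rewrite linearB linearN /= addrCA addrC -f0E fc addrK.
apply: bfunP; elim/fcons_ind => x y.
rewrite bfunDE bfunNE delta_invproj_fcons opprK pullbackE comp_fcons.
(* By invariance of [f0], the decomposition at [g x], translated by [g], is a decomposition of the
   same function [f0(x, _)]. [Bx] is its primitive and [Dx] the coboundary of that primitive, as
   families in [g]. *)
pose Bx : bfun R (inner X * ('I_k -> X)) :=
  bpre (fun u : inner X * ('I_k -> X) => u.1 \o fcons x u.2) B.
pose Dx : bfun R (inner X * ('I_k.+1 -> X)) :=
  bpre snd (bpre (fcons x) f0) -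
  bpre (fun u : inner X * ('I_k.+1 -> X) => (u.1 x, @to_pi0 X \o u.2)) Phi.
have -> : bpre (fcons x) (invproj m B) = average m Bx.
  by apply: bfunP => z; rewrite averageE; congr (m _); exact: bfunP.
rewrite -(@delta_average _ _ _ _ _ Dx) => [|g z]; last first.
  have -> : bpre (pair g) Bx = translate g (p (g x)).2.
    apply: bfunP => t.
    by rewrite -[LHS]/(B (g \o fcons x t)) comp_fcons BE.
  rewrite delta_translate -[RHS]/(delta (p (g x)).2 (g \o z)).
  have [_ _ hpE] := hp (g x).
  have := congr1 (fun u : bfun R _ => u (g \o z)) hpE.
  rewrite bfunDE pullbackE -[LHS]/(f0 (fcons (g x) (g \o z))) -comp_fcons.
  rewrite f0_inv.
  have -> : @to_pi0 X \o (g \o z) = @to_pi0 X \o z.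
    by apply/funext => i; exact: to_pi0_inner.
  rewrite -PhiE => fE.
  rewrite -[LHS]/(f0 (fcons x z) - Phi (g x, @to_pi0 X \o z)) fE.
  by rewrite addrC addKr.
have [h hx] := pi0_repr_inner x.
rewrite !averageE.
pose e : bfun R (inner X) :=
  bpre (fun g : inner X => (g x, @to_pi0 X \o y)) Phi.
have -> : bpre (fun g : inner X => (g, y)) Dx = bcst _ (f0 (fcons x y)) - e.
  exact: bfunP.
(* The representative of the component of [x] is [h x], so the means over [g x] and [g (h x)] agree
   by right translation by [h]. *)
rewrite linearB mean_cst -(mean_inv m h e).
rewrite [X in m X + _](_ : _ = bpre (fun g => g * h)%g e).
  by rewrite addrC subrK.
apply: bfunP => g.
rewrite -[RHS]/(Phi ((g * h)%g x, @to_pi0 X \o y)) innerME -hx.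
rewrite -[LHS]/(Phi (_, _)) /= fcons0; congr (Phi (_, _)).
by apply/funext => i /=; rewrite fcons_lift.
Qed.
End PullbackCohomology.

(** * Generalities on classes and linear isomorphisms *)

Section CohomologyClasses.
Variable R : pzRingType.

Lemma coh_class_eq0 (C : cochain_complex R) k (z : cocycles C k) :
  coh_class z = 0 <-> coboundary (val z).
Proof.
rewrite -(linear0 (coh_class : {linear cocycles C k -> cohomology C k})).
by split=> [/coh_class_eq/asboolP|zb]; [|apply/coh_class_eq/asboolP];
  rewrite subr0.
Qed.

Lemma coboundaryB (C : cochain_complex R) k (c d : C k) :
  coboundary c -> coboundary d -> coboundary (c - d).
Proof.
case: k c d => [|k] c d /=; first by move=> -> ->; rewrite subr0.
by move=> [a ->] [b ->]; exists (a - b); rewrite linearB.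
Qed.

Lemma bijective_inj_surj (S T : Type) (f : S -> T) :
  injective f -> (forall t, exists s, f s = t) -> bijective f.
Proof.
move=> finj /choice[g fgK]; exists g => // s.
by apply: finj; rewrite fgK.
Qed.

Lemma lmod_isomorphic_sym (U V : lmodType R) :
  lmod_isomorphic U V -> lmod_isomorphic V U.
Proof.
case=> f [g fK gK]; have glin := can2_linear fK gK.
pose G : {linear V -> U} := HB.pack g (GRing.isLinear.Build R V U _ g glin).
by exists G, f.
Qed.

Lemma lmod_isomorphic_trans (U V W : lmodType R) :
  lmod_isomorphic U V -> lmod_isomorphic V W -> lmod_isomorphic U W.
Proof. by move=> [f fb] [g gb]; exists (g \o f); exact: bij_comp. Qed.
End CohomologyClasses.

(** * The two isomorphisms in cohomology *)

Section Isomorphisms.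
Variables (R : realType) (X : rackType) (m : right_invariant_mean R (inner X)).
Hypothesis psi_norm_bounded : finite_diameter X.

Lemma invproj_sub_coboundary k (f : bounded_complex R X k) :
  delta f = 0 -> coboundary (invproj m f - f : bounded_complex R X k).
Proof.
case: k f => [|k] f df0 /=.
  (* In degree 0 only 0 is a coboundary, but the sole tuple is empty, so [f] is already
     invariant. *)
  rewrite invproj_id ?subrr// => g x; congr (f _).
  by apply/funext => -[].
have [N normN] := psi_norm_bounded; have [M fM] := bfun_bound f.
have [b _ ->] := invproj_cohomologous m normN df0 fM.
by exists b; rewrite addrC addKr.
Qed.

Lemma coboundary_ibfun k (f : invariant_complex R X k) :
  coboundary f -> coboundary (ibfun_val f : bounded_complex R X k).
Proof.
case: k f => [|k] f /=; first by move=> ->.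
by move=> [b ->]; exists (ibfun_val b).
Qed.

Lemma coh_projection_bij k : bijective (coh_map (projection m) k).
Proof.
apply: bijective_inj_surj.
  suff ker0 c : coh_map (projection m) k c = 0 -> c = 0 by exact: raddf_inj.
  elim/coh_class_ind: c => z; rewrite coh_mapE.
  move=> /coh_class_eq0/coboundary_ibfun Pz.
  apply/coh_class_eq0; case: z Pz => f /= /asboolP df0 Pf.
  (* [f] is its average minus the difference of the two, and both are coboundaries. *)
  rewrite -[f](subKr (invproj m f)); apply: coboundaryB => //.
  exact: invproj_sub_coboundary.
elim/coh_class_ind=> -[f fcoc].
have df0 : idelta f = 0 by exact/asboolP.
have df0' : is_cocycle (ibfun_val f : bounded_complex R X k).
  by apply/asboolP; exact: (congr1 (@ibfun_val _ _ _) df0).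
(* Surjectivity: an invariant cocycle is fixed by the projection. *)
exists (coh_class (Cocycle df0')); rewrite coh_mapE; congr (coh_class _).
apply: val_inj; apply: val_inj.
have /asboolP finv : is_invariant (ibfun_val f) := valP f.
exact: (invproj_id m finv).
Qed.

Lemma pi_star_bij k : bijective (@pi_star R X k).
Proof.
apply: bijective_inj_surj.
  apply: raddf_inj => phi /coh_class_eq0 /=.
  case: k phi => [|k] phi; last by case=> b; exact: (pullback_coboundary0 m).
  move=> phi0; apply: bfunP => a; rewrite -(comp_pi0_reprK a) -pullbackE.
  by rewrite [pullback phi]phi0.
elim/coh_class_ind=> -[f fcoc]; case: k f fcoc => [|k] f fcoc.
  exists (bpre (fun a : 'I_0 -> pi0 X => @pi0_repr X \o a) f).
  congr (coh_class _); apply: val_inj; apply: bfunP => x.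
  by rewrite -[LHS]/(f _); congr (f _); apply/funext => -[].
have df0 : delta f = 0 by exact/asboolP.
have [N normN] := psi_norm_bounded; have [M fM] := bfun_bound f.
have [C /(_ f df0 fM)[phi [b [_ _ fE]]]] := cocycle_pullback m k M normN.
exists phi; apply/coh_class_eq/asboolP; exists (- b).
by rewrite /= linearN /= {1}fE opprD addNKr.
Qed.
End Isomorphisms.

Theorem theorem6p3 (R : realType) (X : rackType)
    (G_amenable : amenable R (inner X))
    (psi_norm_bounded : finite_diameter X) :
  (forall (m : right_invariant_mean R (inner X)) (k : nat),
     bijective (coh_map (projection m) k)) /\
  (forall k : nat, bijective (@pi_star R X k)) /\
  (forall k : nat,
     lmod_isomorphic (bfun R ('I_k -> pi0 X))
                     (cohomology (invariant_complex R X) k) /\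
     lmod_isomorphic (cohomology (invariant_complex R X) k)
                     (cohomology (bounded_complex R X) k)).
Proof.
have [m] := G_amenable.
have projb m' k := coh_projection_bij m' psi_norm_bounded k.
have pib k := pi_star_bij m psi_norm_bounded k.
split; [exact: projb | split; [exact: pib|]] => k.
have piI : lmod_isomorphic (bfun R ('I_k -> pi0 X))
    (cohomology (bounded_complex R X) k) by exists (@pi_star R X k).
have projI : lmod_isomorphic (cohomology (bounded_complex R X) k)
    (cohomology (invariant_complex R X) k) by exists (coh_map (projection m) k).
by split; [exact: lmod_isomorphic_trans piI projI|exact: lmod_isomorphic_sym].
Qed.
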